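(* Let $n\ge 1$. The stopping rule $$\tau_n=\min\{\,1\le i\le 2n:\ X_i=1,\ S_i=2\ \text{and}\ D_i\ge r_n\,\}$$ (with $\min\varnothing:=2n$) is optimal for the problem of maximizing $P(R_\tau=1)$ over $\tau\in\mathcal{M}_n$; that is, $\tau_n\in\mathcal{M}_n$ and $$P(R_{\tau_n}=1)=\sup_{\tau\in\mathcal{M}_n}P(R_\tau=1).$$ In other words, the optimal rule stops on the first $T_j$ with $D_{T_j}\ge r_n$ and $S_{T_j}=2$.
   Context: Fix an integer $n\ge1$. There are $2n$ applicants with absolute ranks $1,1,2,2,\ldots,n,n$ (1 is best, $n$ is worst), interviewed in a uniformly random order: $R_j$ denotes the absolute rank of the $j$-th applicant, $j=1,\ldots,2n$, and $P\bigl((R_1,\ldots,R_{2n})=\sigma\bigr)=2^n/(2n)!$ for every distinct arrangement $\sigma$ of the multiset $(1,1,2,2,\ldots,n,n)$. For $1\le j\le 2n$: - $X_j$ is the number of distinct values in $\{R_i:\ R_i\le R_j,\ 1\le i\le j\}$ (the relative rank of the $j$-th applicant among the first $j$). - $D_j$ is the number of distinct values in $\{R_1,\ldots,R_j\}$. - $S_j\in\{1,2\}$ is the number of times the relatively best rank has appeared up to time $j$, i.e. $S_j=\#\{1\le i\le j:\ R_i=\min_{1\le k\le j}R_k\}$. $\mathcal{F}_j$ is the $\sigma$-algebra generated by $(X_1,D_1),\ldots,(X_j,D_j)$, and $\mathcal{M}_n$ is the set of all stopping rules (stopping times) with values in $\{1,\ldots,2n\}$ adapted to the filtration $\{\mathcal{F}_j\}_{1\le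 j\le 2n}$. The times $T_j$ are the times at which the successive relatively best applicants appear: $T_1=1$ and, for $j=2,\ldots,2n$, $T_j=\min\{i: i>T_{j-1},\ X_i=1\}$, with $\min\varnothing:=2n$. For $i=1,\ldots,n$ let $$\alpha(i)=\frac{2n}{i}+\sum_{j=i+1}^{n}\frac{1}{j-1}$$ (empty sums are $0$), and let $r_n=\min\{\,i\ge 1:\ \alpha(i)\le 5\,\}$. *)

(* Defs.v *)
From HB Require Import structures.
From mathcomp Require Import all_boot all_order all_algebra.
From mathcomp Require Import all_classical all_reals all_analysis.

Set Implicit Arguments.
Unset Strict Implicit.
Unset Printing Implicit Defensive.

Import Order.TTheory GRing.Theory Num.Theory.

Local Open Scope classical_set_scope.
Local Open Scope ring_scope.

(* Times and ranks are 1-based naturals: an interview sequence [r : nat -> nat]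
   gives the absolute rank [r j] of the [j]-th applicant for 1 <= j <= 2n, and
   its values outside that range are never used. *)

Definition rank_multiset (n : nat) : seq nat :=
  flatten [seq [:: k; k] | k <- iota 1 n].

Definition relrank (r : nat -> nat) (j : nat) : nat :=
  size (undup [seq r i | i <- iota 1 j & (r i <= r j)%N]).

Definition ndistinct (r : nat -> nat) (j : nat) : nat :=
  size (undup [seq r i | i <- iota 1 j]).

Definition nbest (r : nat -> nat) (j : nat) : nat :=
  count_mem (\big[minn/r 1%N]_(1 <= k < j.+1) r k) [seq r i | i <- iota 1 j].

(* Here and below, the default value [n.*2] of the big minimum encodes the
   convention that the minimum of the empty set is 2n. *)
Fixpoint best_time (n : nat) (r : nat -> nat) (j : nat) : nat :=
  match j with
  | 0 => 0%N
  | 1 => 1%N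
  | j'.+1 => \big[minn/n.*2]_(1 <= i < n.*2.+1
               | (best_time n r j' < i)%N && (relrank r i == 1%N)) i
  end.

Definition alpha (n i : nat) : rat :=
  n.*2%:R / i%:R + \sum_(i.+1 <= j < n.+1) (j%:R - 1)^-1.

(* The default value [n] is harmless: alpha n n = 2 <= 5 when 1 <= n. *)
Definition threshold (n : nat) : nat :=
  \big[minn/n]_(1 <= i < n.+1 | alpha n i <= 5) i.

Definition tau_opt (n : nat) (r : nat -> nat) : nat :=
  \big[minn/n.*2]_(1 <= i < n.*2.+1 | [&& relrank r i == 1%N,
     nbest r i == 2%N & (threshold n <= ndistinct r i)%N]) i.

Definition first_good_best_time (n : nat) (r : nat -> nat) : nat :=
  \big[minn/n.*2]_(1 <= j < n.*2.+1 |
     (threshold n <= ndistinct r (best_time n r j))%N &&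
     (nbest r (best_time n r j) == 2%N)) best_time n r j.

Section Model.
Context d (T : measurableType d) (R : realType) (P : probability T R).
Implicit Types (n j : nat) (rk : nat -> {RV P >-> nat}) (tau : T -> nat).

Definition ranks rk (w : T) : nat -> nat := fun j => rk j w.

Definition uniform_order n rk : Prop :=
  forall s : seq nat, perm_eq s (rank_multiset n) ->
    P [set w | [seq rk j w | j <- iota 1 n.*2] = s] =
      ((2 ^ n)%N%:R / (n.*2)`!%:R)%:E.

(* Time i is the ordinal of value i - 1. *)
Definition observed_filtration rk j : set (set T) :=
  g_sigma_preimage (fun (i : 'I_j) (w : T) =>
    (relrank (ranks rk w) i.+1, ndistinct (ranks rk w) i.+1)).

Definition stopping_rule n rk tau : Prop :=
  (forall w, (1 <= tau w <= n.*2)%N) /\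
  (forall j, (1 <= j <= n.*2)%N ->
     observed_filtration rk j [set w | (tau w <= j)%N]).

Definition success_prob rk tau : \bar R := P [set w | rk (tau w) w = 1%N].

End Model.

(* Main.v *)
Require Import Defs.
From mathcomp Require Import all_boot all_order all_algebra.
From mathcomp Require Import ring lra zify.
From mathcomp Require Import all_classical all_reals all_analysis.

Set Implicit Arguments.
Unset Strict Implicit.
Unset Printing Implicit Defensive.

Import Order.TTheory GRing.Theory Num.Theory.

Local Open Scope ring_scope.

(* What is observed up to time j is the order pattern of the first j ranks.
   Given a pattern with d distinct values, every continuation is equally likely,
   so stopping at a current best wins with probability d/n whatever the rest of
   the pattern. The optimal win probability from then on depends only on d and
   on whether the current best has appeared once (u d) or twice (v d):
     (2(n-d)+1) u d = 2(n-d) u (d+1) + max(d/n, v d),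
     (d+1) v d = u (d+1) + d v (d+1),   u n = 1,   v n = 0.
   Since u d >= d/n one never stops on a first appearance. While stopping at
   every second appearance is optimal from d on, u d = d/(3n) + 2/3 and
   v d = d (alpha d - 2)/(3n), so v d <= d/n iff alpha d <= 5; below the
   threshold v d >= d/n propagates downwards. *)

(** * The threshold and the value functions *)

(** The default m always counts as a candidate, so comparing such a minimum with a bound never needs
    a nonempty range. *)
Lemma bigminn_leq (I : Type) (s : seq I) (Q : pred I) (F : I -> nat) m t :
  ((\big[minn/m]_(i <- s | Q i) F i <= t) =
   (m <= t) || has (fun i => Q i && (F i <= t)) s)%N.
Proof.
elim: s => [|i s IH]; first by rewrite big_nil orbF.
rewrite big_cons /=; case: (Q i) => //=.
by rewrite geq_min IH orbCA.
Qed.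

Lemma bigminn_leqP (m a b : nat) (Q : pred nat) (F : nat -> nat) t :
  reflect ((m <= t)%N \/ exists i, [/\ (a <= i < b)%N, Q i & (F i <= t)%N])
          (\big[minn/m]_(a <= i < b | Q i) F i <= t)%N.
Proof.
rewrite bigminn_leq; apply: (iffP orP) => -[H|H]; [by left| |by left|].
- by right; case/hasP: H => i; rewrite mem_index_iota => ? /andP[? ?]; exists i.
- right; case: H => i [? ? ?]; apply/hasP; exists i; rewrite ?mem_index_iota //.
  exact/andP.
Qed.

Lemma alphaS (n i : nat) : (0 < i < n)%N ->
  alpha n i = alpha n i.+1 + 2 * n%:R / (i%:R * i.+1%:R) + i%:R^-1.
Proof.
move=> /andP[i0 iN]; rewrite /alpha big_ltn; last by lia.
rewrite -(@natr1 rat i) addrK -muln2 natrM.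
have i0' : (i%:R : rat) != 0 by rewrite pnatr_eq0; lia.
have i1' : (i%:R + 1 : rat) != 0 by rewrite natr1 pnatr_eq0.
by field; apply/andP.
Qed.

Lemma alphann (n : nat) : (0 < n)%N -> alpha n n = 2.
Proof.
move=> n0; rewrite /alpha big_geq // addr0 -muln2 natrM.
have n0' : (n%:R : rat) != 0 by rewrite pnatr_eq0; lia.
by rewrite mulrAC divff // mul1r.
Qed.

Lemma alpha_le (n i j : nat) : (0 < i)%N -> (i <= j <= n)%N ->
  alpha n j <= alpha n i.
Proof.
move=> i0; elim: j => [|j IH] /andP[ij jn]; first by lia.
move: ij; rewrite leq_eqVlt ltnS => /orP[/eqP -> //|ij].
apply: le_trans (IH _); last by lia.
rewrite (@alphaS n j); last by lia.
by rewrite -addrA lerDl addr_ge0 // ?mulr_ge0 ?invr_ge0 ?mulr_ge0.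
Qed.

Lemma threshold_gt0 n : (0 < n)%N -> (0 < threshold n)%N.
Proof.
move=> n0; rewrite ltnNge; apply/negP => /bigminn_leqP[|[i []]]; lia.
Qed.

(** [alpha n] is nonincreasing on 1..n, so the indices with alpha <= 5 form an up-set; the default n
    lies in it because [alpha n n] is 2. *)
Lemma thresholdP (n d : nat) : (0 < d <= n)%N ->
  (threshold n <= d)%N = (alpha n d <= 5).
Proof.
move=> dn; apply/bigminn_leqP/idP => [[nd|[i [iI Hi id]]]|H].
- have -> : d = n by lia.
  by rewrite alphann //; lia.
- by apply: le_trans Hi; apply: alpha_le; lia.
- by right; exists d; split => //; lia.
Qed.

(* Optimal win probabilities when n - e distinct ranks have been seen and the
   current best has appeared once, resp. twice. *)
Fixpoint value (n e : nat) : rat * rat :=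
  if e is e'.+1 then
    let d : rat := (n - e)%:R in
    let v := ((value n e').1 + d * (value n e').2) / (d + 1) in
    ((2 * e%:R * (value n e').1 + Num.max (d / n%:R) v) / (2 * e%:R + 1), v)
  else (1, 0).

Definition value_once (n d : nat) : rat := (value n (n - d)).1.
Definition value_twice (n d : nat) : rat := (value n (n - d)).2.

Section Values.
Variable n : nat.
Hypothesis n_gt0 : (0 < n)%N.
Let nR : 0 < n%:R :> rat. Proof. by rewrite ltr0n. Qed.
(** The closed form of v d is d/n times (a - 2)/3 with a = alpha d, and (a - 2)/3 passes 1 exactly
    at a = 5: this is the origin of the constant 5. *)
Let value_factor (x a : rat) :
  x / (3 * n%:R) * (a - 2) = x / n%:R * ((a - 2) / 3).
Proof. by field; rewrite gt_eqF. Qed.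
Notation u := (value_once n).
Notation v := (value_twice n).

Lemma value_once_max : u n = 1.
Proof. by rewrite /value_once subnn. Qed.

Lemma value_twice_max : v n = 0.
Proof. by rewrite /value_twice subnn. Qed.

Lemma value_twice_rec (d : nat) : (d < n)%N ->
  (d%:R + 1) * v d = u d.+1 + d%:R * v d.+1.
Proof.
move=> dn; rewrite /value_twice /value_once.
have -> : (n - d = (n - d.+1).+1)%N by lia.
rewrite /=; have -> : (n - (n - d.+1).+1 = d)%N by lia.
by rewrite mulrC divfK // natr1 pnatr_eq0.
Qed.

(** For d < n this unfolds the fixpoint. At d = n the coefficient of [u d.+1] vanishes and the
    maximum is 1, so the end of the recursion needs no separate treatment later. *)
Lemma value_once_rec (d : nat) : (d <= n)%N ->
  2 * (n - d)%:R * u d.+1 + Num.max (d%:R / n%:R) (v d) =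
  (2 * (n - d)%:R + 1) * u d.
Proof.
rewrite leq_eqVlt => /orP[/eqP->|dn].
  rewrite subnn value_once_max value_twice_max divff; last by rewrite gt_eqF.
  by rewrite max_l // mulr0 mul0r !add0r mul1r.
rewrite /value_twice /value_once.
have -> : (n - d = (n - d.+1).+1)%N by lia.
rewrite [in RHS]/= [in X in Num.max _ X]/=.
have -> : (n - (n - d.+1).+1 = d)%N by lia.
rewrite [in RHS]mulrC divfK // gt_eqF // ltr_wpDl //.
Qed.

(** Downward induction: with m = n - d, the recursion gives (2m+1) u d >= 2m (d+1)/n + d/n >= (2m+1)
    d/n. *)
Lemma value_once_ge (d : nat) : (d <= n)%N -> d%:R / n%:R <= u d.
Proof.
have [e] := ubnP (n - d); elim: e d => // e IH d; rewrite ltnS => de dn.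
have H := value_once_rec dn.
move: dn; rewrite leq_eqVlt => /orP[/eqP dn|dn].
  by rewrite dn value_once_max divff // gt_eqF.
have := IH d.+1; rewrite -(@natr1 rat d) mulrDl => /(_ _ dn) IHd.
have {}IHd : d%:R / n%:R + 1 / n%:R <= u d.+1 by apply: IHd; lia.
have : d%:R / n%:R <= Num.max (d%:R / n%:R) (v d) by rewrite le_max lexx.
have : 0 <= 1 / n%:R :> rat by rewrite divr_ge0.
move: H IHd; set x := _ / _; set y := 1 / _; set z := Num.max _ _.
set m := (n - d)%:R; have : 0 <= m :> rat by [].
nra.
Qed.

(** Downward induction. [alphaS] is what the recursion for v asks of alpha, and alpha <= 5 then
    makes the maximum in the recursion for u equal to the stopping reward, which leaves a linear
    recursion. Writing the index as [d.+1] keeps it positive. *)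
Lemma value_above_threshold (d : nat) : (threshold n <= d.+1)%N -> (d < n)%N ->
  u d.+1 = d.+1%:R / (3 * n%:R) + 2 / 3 /\
  v d.+1 = d.+1%:R / (3 * n%:R) * (alpha n d.+1 - 2).
Proof.
have [e] := ubnP (n - d.+1); elim: e d => // e IH d; rewrite ltnS => de rd dn.
move: (dn); rewrite leq_eqVlt => /orP[/eqP dn1|dn1].
  rewrite dn1 value_once_max value_twice_max alphann // subrr mulr0; split=> //.
  by field; rewrite gt_eqF.
have [|||IHu IHv] := IH d.+1; [lia|lia|lia|].
have Hv := value_twice_rec dn1; have Hu := value_once_rec (ltnW dn1).
have Ha : alpha n d.+1 <= 5 by rewrite -thresholdP //; lia.
have aS := @alphaS n d.+1 dn1.
have d0 : 0 < d.+1%:R :> rat by rewrite ltr0n.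
have d2 : 0 < d.+1%:R + 1 :> rat by rewrite natr1 ltr0n.
have vE : v d.+1 = d.+1%:R / (3 * n%:R) * (alpha n d.+1 - 2).
  apply: (mulfI (lt0r_neq0 d2)); rewrite Hv IHu IHv aS -!(@natr1 rat d.+1).
  move: nR d0 d2; set x := d.+1%:R; set y := n%:R => y0 x0 x1.
  field; rewrite !gt_eqF //.
split=> //.
move: Hu; rewrite max_l; last first.
  rewrite vE value_factor ler_piMr ?divr_ge0 //; lra.
rewrite IHu => Hu.
have m0 : 0 < 2 * (n - d.+1)%:R + 1 :> rat by rewrite ltr_wpDl // mulr_ge0.
apply: (mulfI (lt0r_neq0 m0)); rewrite -Hu natrB // -!(@natr1 rat d.+1).
by field; rewrite gt_eqF.
Qed.

Lemma value_twice_le (d : nat) : (threshold n <= d <= n)%N ->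
  v d <= d%:R / n%:R.
Proof.
case: d => [|d] /andP[rd dn]; first by move: (threshold_gt0 n_gt0); lia.
have [_ ->] := value_above_threshold rd dn.
have Ha : alpha n d.+1 <= 5 by rewrite -thresholdP //; lia.
rewrite value_factor ler_piMr ?divr_ge0 //; lra.
Qed.

Lemma value_twice_ge0 (d : nat) : (d <= n)%N -> 0 <= v d.
Proof.
have [e] := ubnP (n - d); elim: e d => // e IH d; rewrite ltnS => de.
rewrite leq_eqVlt => /orP[/eqP ->|dn]; first by rewrite value_twice_max.
have d0 : 0 < d%:R + 1 :> rat by rewrite natr1 ltr0n.
rewrite -(pmulr_rge0 _ d0) value_twice_rec // addr_ge0 ?mulr_ge0 ?IH //; last by lia.
by apply: le_trans (value_once_ge dn); rewrite divr_ge0.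
Qed.

(** If the bound holds at d+1, then together with u (d+1) >= (d+1)/n the recursion gives (d+1) v d
    >= (d+1)^2/n. Just below the threshold, the closed forms at d+1 yield the same formula for v d,
    now with alpha d > 5. *)
Lemma value_twice_ge (d : nat) : (d < threshold n)%N -> (d <= n)%N ->
  d%:R / n%:R <= v d.
Proof.
have [e] := ubnP (n - d); elim: e d => // e IH d; rewrite ltnS => de dr dn.
have rn : (threshold n <= n)%N by apply/bigminn_leqP; left.
have dn1 : (d < n)%N by lia.
have Hv := value_twice_rec dn1.
have d2 : 0 < d%:R + 1 :> rat by rewrite natr1 ltr0n.
have Hu := value_once_ge dn1.
have [dr1|rd] := ltnP d.+1 (threshold n).
  have IHd : d.+1%:R / n%:R <= v d.+1 by apply: IH; lia.
  rewrite -(ler_pM2l d2) Hv; move: Hu IHd; rewrite -!(@natr1 rat d).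
  have : 0 < n%:R^-1 :> rat by rewrite invr_gt0.
  have : 0 <= d%:R :> rat by [].
  move: d2; set x := d%:R; set y := n%:R^-1; set w := v d.+1; nra.
(* [alpha n 0] divides by zero, so d = 0 is settled apart: there v 0 = u 1. *)
case: (posnP d) => [d0|d0].
  move: Hv Hu; rewrite d0 add0r !mul0r addr0 !mul1r => -> .
  by apply: le_trans; rewrite ?divr_ge0.
have [uE vE] := value_above_threshold rd dn1.
have aS := @alphaS n d; rewrite d0 dn1 in aS.
have : 5 < alpha n d by rewrite ltNge -thresholdP ?d0 // -ltnNge.
have dR : 0 < d%:R :> rat by rewrite ltr0n.
have -> : v d = d%:R / (3 * n%:R) * (alpha n d - 2).
  apply: (mulfI (lt0r_neq0 d2)); rewrite Hv uE vE aS // -!(@natr1 rat d).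
  move: nR dR d2; set x := d%:R; set y := n%:R => y0 x0 x1.
  field; rewrite !gt_eqF //.
move=> Ha.
rewrite value_factor ler_peMr ?divr_ge0 //; lra.
Qed.

End Values.

(** * Observations *)

Definition obs (r : nat -> nat) (j : nat) : seq (nat * nat) :=
  [seq (relrank r i, ndistinct r i) | i <- iota 1 j].

(* The leading [0%N] makes the 0-based list a 1-based rank function. *)
Definition rank_fun (l : seq nat) (i : nat) : nat := nth 0%N (0%N :: l) i.

Lemma relrank_mono (f : nat -> nat) (r r' : nat -> nat) j : (0 < j)%N ->
  {mono f : x y / (x <= y)%N} ->
  (forall i, (0 < i <= j)%N -> r' i = f (r i)) -> relrank r' j = relrank r j.
Proof.
move=> j0 fmono rf; rewrite /relrank.
have jI : (0 < j <= j)%N by rewrite j0 /=.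
have -> : [seq i <- iota 1 j | (r' i <= r' j)%N] =
          [seq i <- iota 1 j | (r i <= r j)%N].
  by apply: eq_in_filter => i; rewrite mem_iota add1n ltnS => iI;
    rewrite !rf // fmono.
have -> : [seq r' i | i <- iota 1 j & (r i <= r j)%N] =
          map f [seq r i | i <- iota 1 j & (r i <= r j)%N].
  rewrite -map_comp; apply/eq_in_map => i.
  by rewrite mem_filter mem_iota add1n ltnS => /andP[_ /rf].
by rewrite undup_map_inj ?size_map //; apply: incn_inj.
Qed.

Lemma ndistinct_mono (f : nat -> nat) (r r' : nat -> nat) j :
  {mono f : x y / (x <= y)%N} ->
  (forall i, (0 < i <= j)%N -> r' i = f (r i)) ->
  ndistinct r' j = ndistinct r j.
Proof.
move=> fmono rf; rewrite /ndistinct.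
have -> : [seq r' i | i <- iota 1 j] = map f [seq r i | i <- iota 1 j].
  rewrite -map_comp; apply/eq_in_map => i.
  by rewrite mem_iota add1n ltnS => /rf.
by rewrite undup_map_inj ?size_map //; apply: incn_inj.
Qed.

(** Observations see ranks only through comparisons, so an order pattern can stand in for the prefix
    of any of its completions. *)
Lemma obs_mono (f : nat -> nat) (r r' : nat -> nat) j :
  {mono f : x y / (x <= y)%N} ->
  (forall i, (0 < i <= j)%N -> r' i = f (r i)) -> obs r' j = obs r j.
Proof.
move=> fmono rf; apply/eq_in_map => i; rewrite mem_iota add1n ltnS => iI.
have rf' k : (0 < k <= i)%N -> r' k = f (r k) by move=> kI; apply: rf; lia.
rewrite (relrank_mono _ fmono rf') ?(ndistinct_mono fmono rf') //; lia.
Qed.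

Lemma eq_obs (r r' : nat -> nat) j :
  (forall i, (0 < i <= j)%N -> r' i = r i) -> obs r' j = obs r j.
Proof. exact: (@obs_mono id). Qed.

Lemma obsP (r r' : nat -> nat) j :
  obs r j = obs r' j <->
  (forall i, (0 < i <= j)%N ->
    relrank r i = relrank r' i /\ ndistinct r i = ndistinct r' i).
Proof.
split=> [H i iI|H].
  by move/eq_in_map: H => /(_ i); rewrite mem_iota add1n ltnS => /(_ iI)[].
by apply/eq_in_map => i; rewrite mem_iota add1n ltnS => /H[-> ->].
Qed.

Lemma obs_prefix (r r' : nat -> nat) i j : (i <= j)%N ->
  obs r j = obs r' j -> obs r i = obs r' i.
Proof. by move=> ij /obsP H; apply/obsP => k kI; apply: H; lia. Qed.

(** * Running minimum and multiplicity of the current best *)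

Definition running_min (r : nat -> nat) j :=
  (\big[minn/r 1%N]_(1 <= k < j.+1) r k)%N.

Lemma running_minS r j : (0 < j)%N ->
  running_min r j.+1 = minn (running_min r j) (r j.+1).
Proof.
move=> j0.
have leE t : (running_min r j.+1 <= t)%N =
             (minn (running_min r j) (r j.+1) <= t)%N.
  rewrite geq_min /running_min !bigminn_leq /index_iota !subSS !subn0.
  by rewrite -{1}(addn1 j) iotaD has_cat /= add1n orbF orbA.
by apply/eqP; rewrite eqn_leq leE leqnn -leE leqnn.
Qed.

Lemma running_min_le r i j : (0 < i <= j)%N -> (running_min r j <= r i)%N.
Proof. by move=> iI; apply/bigminn_leqP; right; exists i; split => //; lia. Qed.

Lemma running_min_mem r j : (0 < j)%N ->
  running_min r j \in [seq r i | i <- iota 1 j].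
Proof.
elim: j => // j IH _; case: (posnP j) => [->|j0].
  by rewrite /running_min big_nat1_id minnn inE.
rewrite running_minS // -addn1 iotaD map_cat mem_cat.
by case: leqP => _; rewrite ?IH // inE addnC eqxx orbT.
Qed.

Lemma mem_running_min r j x : (0 < j)%N ->
  x \in [seq r i | i <- iota 1 j] -> (running_min r j <= x)%N.
Proof.
move=> j0 /mapP[i]; rewrite mem_iota => iI ->; apply: running_min_le; lia.
Qed.

Lemma relrank_eq1 r j : (0 < j)%N ->
  (relrank r j == 1%N) = (r j == running_min r j).
Proof.
move=> j0; rewrite /relrank.
set s := map _ _.
have js : r j \in s.
  by apply: map_f; rewrite mem_filter leqnn mem_iota add1n ltnS j0 /=.
apply/idP/eqP => [|Hj].
  case E : (undup s) => [|x [|y t]] // _.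
  have {}E : s =i [:: x] by move=> z; rewrite -mem_undup E.
  have := js; rewrite E inE => /eqP jx.
  apply/eqP; rewrite eqn_leq running_min_le ?j0 ?leqnn // andbT leqNgt.
  apply/negP => lt; have /mapP[i iI Hi] := running_min_mem r j0.
  have : r i \in s by apply: map_f; rewrite mem_filter iI -Hi ltnW.
  by rewrite E inE -jx => /eqP H; rewrite Hi H ltnn in lt.
have sE : {subset s <= [:: r j]}.
  move=> x /mapP[i]; rewrite mem_filter mem_iota => /andP[ij iI] ->.
  by rewrite inE eqn_leq ij Hj running_min_le //; lia.
have : (size (undup s) <= size [:: r j])%N.
  by apply: uniq_leq_size; [exact: undup_uniq|]
    => x; rewrite mem_undup => /sE.
rewrite eqn_leq => -> /=.
by have := js; rewrite -mem_undup; case: (undup s).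
Qed.

Lemma ndistinctS r j :
  ndistinct r j.+1 =
  ((r j.+1 \notin [seq r i | i <- iota 1 j]) + ndistinct r j)%N.
Proof.
rewrite /ndistinct -[in LHS](addn1 j) iotaD map_cat /= add1n.
set s := map _ _.
have /perm_undup/perm_size -> : s ++ [:: r j.+1] =i r j.+1 :: s.
  by move=> x; rewrite mem_cat inE [in RHS]inE orbC.
by rewrite /=; case: (_ \in _).
Qed.

(** A relatively best newcomer repeats the current best if the number of distinct values stays put,
    and beats it strictly otherwise. Hence S is a function of the observed pairs (X, D), although it
    is not among them. *)
Lemma nbestS r j : (0 < j)%N ->
  nbest r j.+1 =
  if relrank r j.+1 == 1%N then
    if ndistinct r j.+1 == ndistinct r j then (nbest r j).+1 else 1%N
  else nbest r j.
Proof.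
move=> j0; rewrite relrank_eq1 // running_minS // ndistinctS.
rewrite /nbest -!/(running_min _ _) running_minS //.
have -> : [seq r i | i <- iota 1 j.+1] = [seq r i | i <- iota 1 j] ++ [:: r j.+1].
  by rewrite -[in LHS](addn1 j) iotaD map_cat /= add1n.
rewrite count_cat /= addn0.
case: (ltnP (r j.+1) (running_min r j)) => [lt|le]; last first.
  case: eqP => [e|_]; last by rewrite addn0.
  by rewrite e running_min_mem // eqxx addn1.
rewrite eqxx.
have /negbTE -> : r j.+1 \notin [seq r i | i <- iota 1 j].
  by apply/negP => /mem_running_min -/(_ j0); rewrite leqNgt lt.
rewrite /= -[X in _ == X]add0n eqn_add2r /=.
rewrite (count_memPn _) //.
by apply/negP => /mem_running_min -/(_ j0); rewrite leqNgt lt.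
Qed.

Lemma nbest_obs r r' j : (0 < j)%N -> obs r j = obs r' j ->
  nbest r j = nbest r' j.
Proof.
elim: j => // j IH _ E; case: (posnP j) => [->|j0].
  by rewrite /nbest !big_nat1_id !minnn /= !eqxx.
have /obsP E' := E; rewrite !nbestS // (IH _ (obs_prefix (leqnSn j) E)) //.
have [<- <-] := E' j.+1 (ltnSn _).
by have [|_ <-] := E' j _; first by lia.
Qed.

(** * Order patterns and their extensions *)

(* The order pattern of an interview prefix is encoded by its dense ranks: the
   values are exactly 1..d, each occurring at most twice. *)
Definition dense (d : nat) (p : seq nat) : Prop :=
  forall v, (v \in p) = (0 < v <= d)%N /\ (count_mem v p <= 2)%N.

Lemma map_rank_fun p : [seq rank_fun p i | i <- iota 1 (size p)] = p.
Proof.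
rewrite -(addn0 1%N) iotaDl -map_comp; apply: (@eq_from_nth _ 0%N).
  by rewrite size_map size_iota.
move=> i; rewrite size_map size_iota => ip.
by rewrite (nth_map 0%N) ?size_iota // nth_iota.
Qed.

Lemma rank_fun_last p x : rank_fun (rcons p x) (size p).+1 = x.
Proof. by rewrite /rank_fun /= nth_rcons ltnn eqxx. Qed.

Lemma dense_ndistinct d p : dense d p -> ndistinct (rank_fun p) (size p) = d.
Proof.
move=> dp; rewrite /ndistinct map_rank_fun -[RHS](size_iota 1 d).
apply/perm_size/uniq_perm; rewrite ?undup_uniq ?iota_uniq // => v.
by rewrite mem_undup mem_iota (dp v).1 add1n ltnS.
Qed.

Lemma dense_relrank d p x : dense d (rcons p x) ->
  relrank (rank_fun (rcons p x)) (size p).+1 = x.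
Proof.
move=> dp; rewrite /relrank rank_fun_last.
have -> : [seq rank_fun (rcons p x) i | i <- iota 1 (size p).+1
            & (rank_fun (rcons p x) i <= x)%N] = [seq v <- rcons p x | (v <= x)%N].
  by rewrite -[in RHS](map_rank_fun (rcons p x)) filter_map size_rcons.
rewrite -[RHS](size_iota 1 x).
apply/perm_size/uniq_perm; rewrite ?undup_uniq ?iota_uniq // => v.
rewrite mem_undup mem_iota mem_filter (dp v).1 add1n ltnS.
have := (dp x).1; rewrite mem_rcons inE eqxx; lia.
Qed.

Lemma dense_nbest d p : (0 < d)%N -> dense d p ->
  nbest (rank_fun p) (size p) = count_mem 1%N p.
Proof.
move=> d0 dp; rewrite /nbest -/(running_min _ _) map_rank_fun.
congr (count_mem _ p).
have p0 : (0 < size p)%N.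
  by have := (dp 1%N).1; rewrite d0; case: (p).
have := running_min_mem (rank_fun p) p0; rewrite map_rank_fun (dp _).1 => /andP[m0 _].
apply/eqP; rewrite eqn_leq m0 andbT; apply: mem_running_min => //.
by rewrite map_rank_fun (dp _).1.
Qed.

Lemma size_sum_count (s p : seq nat) : uniq s -> {subset p <= s} ->
  size p = (\sum_(v <- s) count_mem v p)%N.
Proof.
move=> us; elim: p => [|x p IH] ps; first by rewrite big1.
rewrite /= big_split /= -IH; last by move=> y yp; apply: ps; rewrite inE yp orbT.
have -> : (\sum_(v <- s) (x == v) = \sum_(v <- s | v == x) 1)%N.
  by rewrite [RHS]big_mkcond /=; apply: eq_bigr => v _; rewrite eq_sym; case: eqP.
by rewrite sum1_count count_uniq_mem // ps // inE eqxx.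
Qed.

(* A new applicant either takes a new position x among the distinct values seen
   so far, shifting the values from x on, or repeats a value seen once. *)
Definition children (n d : nat) (p : seq nat) : seq (nat * seq nat) :=
  (if (d < n)%N
   then [seq (d.+1, rcons (map (bump x) p) x) | x <- iota 1 d.+1] else [::]) ++
  [seq (d, rcons p x) | x <- iota 1 d & count_mem x p == 1%N].

(** The patterns reached from p after k more interviews. Since new values shift old ones, p is a
    prefix of a leaf only up to an increasing relabelling, composed along the path in [leavesP]. *)
Fixpoint leaves (n k d : nat) (p : seq nat) : seq (seq nat) :=
  if k is k'.+1 then flatten [seq leaves n k' c.1 c.2 | c <- children n d p]
  else [:: p].

Lemma mem_childrenP n d p c : c \in children n d p ->
  (exists x, [/\ (d < n)%N, (0 < x <= d.+1)%N &
     c = (d.+1, rcons (map (bump x) p) x)]) \/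
  (exists x, [/\ (0 < x <= d)%N, count_mem x p = 1%N & c = (d, rcons p x)]).
Proof.
rewrite mem_cat => /orP[|/mapP[x]].
  case: ifP => // dn /mapP[x]; rewrite mem_iota add1n ltnS => xI ->.
  by left; exists x.
rewrite mem_filter mem_iota add1n ltnS => /andP[/eqP xp xI] ->.
by right; exists x.
Qed.

Lemma count_mem_bump x v p : count_mem v (map (bump x) p) =
  if v == x then 0%N else count_mem (unbump x v) p.
Proof.
rewrite count_map; case: eqP => [->|/eqP vx].
  rewrite -(count_pred0 p); apply: eq_count => u /=.
  by rewrite eq_sym (negbTE (neq_bump _ _)).
apply: eq_count => u /=; apply/eqP/eqP => [<-|->]; first by rewrite bumpK.
by rewrite unbumpK // inE.
Qed.

Lemma dense_new d p x : dense d p -> (0 < x <= d.+1)%N ->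
  dense d.+1 (rcons (map (bump x) p) x).
Proof.
move=> dp xI v; split; last first.
  rewrite -cats1 count_cat /= count_mem_bump; case: eqP => [->|].
    by rewrite eqxx.
  by rewrite eq_sym => /eqP/negbTE ->; rewrite !addn0 (dp _).2.
rewrite mem_rcons inE -has_pred1 has_count count_mem_bump.
case: eqP => [->|vx] /=; first by lia.
rewrite -has_count has_pred1 (dp _).1 /unbump; lia.
Qed.

Lemma dense_rep d p x : dense d p -> count_mem x p = 1%N ->
  dense d (rcons p x).
Proof.
move=> dp xp v; split.
  rewrite mem_rcons inE; case: eqP => [->|_] /=; last exact: (dp v).1.
  by rewrite -(dp x).1 -has_pred1 has_count xp.
rewrite -cats1 count_cat /= addn0; case: eqP => [<-|_].
  by rewrite xp.
by rewrite addn0 (dp v).2.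
Qed.

Lemma dense_children n d p c : dense d p -> (d <= n)%N -> c \in children n d p ->
  [/\ dense c.1 c.2, (c.1 <= n)%N, size c.2 = (size p).+1 &
    exists2 f : nat -> nat, {mono f : x y / (x <= y)%N} &
    forall i, (0 < i <= size p)%N -> rank_fun c.2 i = f (rank_fun p i)].
Proof.
move=> dp dn /mem_childrenP[[x [dn' xI ->]]|[x [xI xp ->]]] /=; split => //.
- exact: dense_new.
- by rewrite size_rcons size_map.
- exists (bump x); first exact: leq_bump2.
  case=> // i /= ip.
  by rewrite /rank_fun /= nth_rcons size_map ip (nth_map 0%N).
- exact: dense_rep.
- by rewrite size_rcons.
- exists id => // -[//|i] /= ip.
  by rewrite /rank_fun /= nth_rcons ip.
Qed.

Lemma children_last n d p c : c \in children n d p ->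
  exists q x, c.2 = rcons q x /\ size q = size p.
Proof.
move=> /mem_childrenP[[x [_ _ ->]]|[x [_ _ ->]]] /=.
  by exists (map (bump x) p), x; rewrite size_map.
by exists p, x.
Qed.

Lemma mem_leavesS n k d p l : l \in leaves n k.+1 d p ->
  exists2 c, c \in children n d p & l \in leaves n k c.1 c.2.
Proof. by move=> /flattenP[_ /mapP[c cI ->] lI]; exists c. Qed.

Lemma leavesP n k d p l : dense d p -> (d <= n)%N -> l \in leaves n k d p ->
  [/\ exists2 d', (d' <= n)%N & dense d' l, size l = (size p + k)%N &
    exists2 f : nat -> nat, {mono f : x y / (x <= y)%N} &
    forall i, (0 < i <= size p)%N -> rank_fun l i = f (rank_fun p i)].
Proof.
elim: k d p => [|k IH] d p dp dn.
  rewrite inE => /eqP ->; split; first by exists d.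
    by rewrite addn0.
  by exists id.
move=> /mem_leavesS[c cI lI].
have [dc cn sc [f fmono fE]] := dense_children dp dn cI.
have [dl sl [g gmono gE]] := IH _ _ dc cn lI; split=> //.
  by rewrite sl sc addSnnS.
exists (g \o f); first by move=> x y /=; rewrite gmono.
by move=> i iI; rewrite /= -fE // gE // sc; lia.
Qed.

Lemma obs_leaf n k d p l j : dense d p -> (d <= n)%N -> l \in leaves n k d p ->
  (j <= size p)%N -> obs (rank_fun l) j = obs (rank_fun p) j.
Proof.
move=> dp dn lI jp; have [_ _ [f fmono fE]] := leavesP dp dn lI.
by apply: (obs_mono fmono) => i iI; apply: fE; lia.
Qed.

(** The observed D tells a new value from a repeated one, and by density the observed X is the
    appended entry itself; the two determine the child. *)
Lemma children_inj n d p c c' : dense d p -> (d <= n)%N ->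
  c \in children n d p -> c' \in children n d p ->
  obs (rank_fun c.2) (size p).+1 = obs (rank_fun c'.2) (size p).+1 -> c = c'.
Proof.
move=> dp dn cI cI' /obsP /(_ (size p).+1) E.
have [dc _ sc _] := dense_children dp dn cI.
have [dc' _ sc' _] := dense_children dp dn cI'.
have [|E1 E2] := E; first by lia.
have {E2} E2 : c.1 = c'.1.
  by rewrite -(dense_ndistinct dc) -(dense_ndistinct dc') sc sc'.
have [q [x [qE sq]]] := children_last cI.
have [q' [x' [qE' sq']]] := children_last cI'.
rewrite qE in dc E1; rewrite qE' in dc' E1.
have {}E1 : x = x'.
  by rewrite -(dense_relrank dc) -(dense_relrank dc') sq sq'.
move: cI cI' => /mem_childrenP[[y [_ _ cE]]|[y [_ _ cE]]]
  /mem_childrenP[[z [_ _ cE']]|[z [_ _ cE']]]; move: E2; rewrite cE cE' /=.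
- move=> _; move: qE qE'; rewrite cE cE' /=.
  by move=> /rcons_inj[_ ->] /rcons_inj[_ ->]; rewrite E1.
- lia.
- lia.
- move=> _; move: qE qE'; rewrite cE cE' /=.
  by move=> /rcons_inj[_ ->] /rcons_inj[_ ->]; rewrite E1.
Qed.

Lemma children_uniq n d p : uniq (children n d p).
Proof.
rewrite cat_uniq; apply/and3P; split.
- case: ifP => // _; rewrite map_inj_uniq ?iota_uniq //.
  by move=> x y [] /rcons_inj[].
- apply/hasPn => _ /mapP[x _ ->]; case: ifP => // _.
  by apply/mapP => -[y _ []]; lia.
- rewrite map_inj_uniq ?filter_uniq ?iota_uniq //.
  by move=> x y [] /rcons_inj[].
Qed.

Lemma uniq_flatten_map (S : eqType) (U : eqType) (f : S -> seq U) s : uniq s ->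
  (forall x, x \in s -> uniq (f x)) ->
  (forall x y z, x \in s -> y \in s -> z \in f x -> z \in f y -> x = y) ->
  uniq (flatten (map f s)).
Proof.
elim: s => //= x s IH /andP[xs us] uf disj; rewrite cat_uniq uf ?inE ?eqxx //=.
rewrite IH ?andbT //; last 2 first.
- by move=> y ys; apply: uf; rewrite inE ys orbT.
- by move=> y z t ys zs; apply: disj; rewrite inE ?ys ?zs orbT.
apply/hasPn => z /flattenP[_ /mapP[y ys ->] zy]; apply/negP => zx.
move: xs; rewrite (disj x y z) ?ys // ?inE ?eqxx //.
by rewrite ys orbT.
Qed.

(** A leaf shows the same observations as the child it descends from, and these identify the child,
    so subtrees of different children are disjoint. *)
Lemma uniq_leaves n k d p : dense d p -> (d <= n)%N -> uniq (leaves n k d p).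
Proof.
elim: k d p => //= k IH d p dp dn.
apply: uniq_flatten_map; first exact: children_uniq.
  by move=> c /(dense_children dp dn)[dc cn _ _]; apply: IH.
move=> c c' l cI cI' lc lc'.
have [dc cn sc _] := dense_children dp dn cI.
have [dc' cn' sc' _] := dense_children dp dn cI'.
apply: (children_inj dp dn cI cI').
by rewrite -(obs_leaf dc cn lc) ?sc // -(obs_leaf dc' cn' lc') ?sc'.
Qed.

(** * Complete patterns as arrangements of the rank multiset *)

Lemma count_rank_multiset n v :
  count_mem v (rank_multiset n) = ((0 < v <= n)%N * 2)%N.
Proof.
rewrite /rank_multiset count_flatten -map_comp.
have -> : (0 < v <= n)%N = (v \in iota 1 n) by rewrite mem_iota add1n ltnS.
rewrite -(count_uniq_mem v (iota_uniq 1 n)).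
elim: (iota 1 n) => //= x s ->; lia.
Qed.

(** Pigeonhole: 2n entries among n values, none used more than twice, force every value to be used
    exactly twice. *)
Lemma full_count n d p v : dense d p -> (d <= n)%N -> size p = n.*2 ->
  (0 < v <= n)%N -> count_mem v p = 2.
Proof.
move=> dp dn sp vI.
have pI : {subset p <= iota 1 n}.
  by move=> w; rewrite (dp w).1 mem_iota add1n ltnS; lia.
have := size_sum_count (iota_uniq 1 n) pI; rewrite sp.
have -> : n.*2 = (\sum_(v <- iota 1 n) 2)%N.
  by rewrite big_const_seq count_predT size_iota iter_addn addn0 mul2n.
have -> : (\sum_(v <- iota 1 n) 2 = \sum_(v <- iota 1 n) count_mem v p +
           \sum_(v <- iota 1 n) (2 - count_mem v p))%N.
  by rewrite -big_split; apply: eq_bigr => w _ /=; rewrite subnKC // (dp w).2.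
move=> E; have : (\sum_(v <- iota 1 n) (2 - count_mem v p) == 0)%N by lia.
rewrite sum_nat_seq_eq0 => /allP /(_ v).
rewrite mem_iota add1n ltnS => /(_ vI) /=.
by rewrite subn_eq0 => p2; apply/eqP; rewrite eqn_leq (dp v).2 p2.
Qed.

Lemma dense_full n d p : dense d p -> (d <= n)%N -> size p = n.*2 -> d = n.
Proof.
move=> dp dn sp; apply/eqP; rewrite eqn_leq dn; case: (posnP n) => [-> //|n0].
have /andP[] // : (0 < n <= d)%N.
by rewrite -(dp n).1 -has_pred1 has_count (full_count dp dn sp) ?n0 /=.
Qed.

Lemma dense_nil : dense 0 [::].
Proof. by move=> v; split=> //=; rewrite in_nil; lia. Qed.

Lemma leaf_perm n l : l \in leaves n n.*2 0 [::] -> perm_eq l (rank_multiset n).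
Proof.
move=> /(leavesP dense_nil (leq0n n))[[d dn dl] sl _].
apply/allP => v _; apply/eqP.
rewrite count_rank_multiset; case: (boolP (0 < v <= n)%N) => [vI|/negP vI].
  by rewrite (full_count dl dn sl vI).
have /count_memPn -> // : v \notin l.
by apply/negP; rewrite (dl v).1 => vd; apply: vI; lia.
Qed.

(* The number of completions of a pattern with d distinct values when k
   interviews are left: choose the d values, then arrange the remaining
   multiset, in which n - d ranks still occur twice. *)
Definition weight (n k d : nat) : rat :=
  'C(n, d)%:R * k`!%:R / 2 ^+ (n - d).

Lemma weight_step n k d : weight n k.+1 d = k.+1%:R * weight n k d.
Proof. by rewrite /weight factS natrM; field; rewrite expf_neq0. Qed.

Lemma weight_new n k d : (d < n)%N ->
  d.+1%:R * weight n k d.+1 = 2 * (n - d)%:R * weight n k d.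
Proof.
move=> dn; rewrite /weight.
have -> : (n - d = (n - d.+1).+1)%N by lia.
rewrite exprS.
have H : d.+1%:R * 'C(n, d.+1)%:R = (n - d.+1).+1%:R * 'C(n, d)%:R :> rat.
  by rewrite -!natrM mul_bin_left subnSK.
rewrite !mulrA H; field; rewrite expf_neq0 //.
Qed.

Lemma weight_gt0 n k d : (d <= n)%N -> 0 < weight n k d.
Proof.
move=> dn; rewrite /weight mulr_gt0 ?invr_gt0 ?exprn_gt0 // mulr_gt0 ?ltr0n //.
  by rewrite bin_gt0.
exact: fact_gt0.
Qed.

(** * Weighted sums over the children of a pattern *)

Lemma sum_new d (g : nat -> rat) a b : g 1%N = a ->
  (forall x, (1 < x <= d.+1)%N -> g x = b) ->
  \sum_(x <- iota 1 d.+1) g x = a + d%:R * b.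
Proof.
move=> ga gb; rewrite /= big_cons ga; congr (_ + _).
rewrite big_seq (eq_bigr (fun=> b)); last first.
  by move=> x; rewrite mem_iota => xI; apply: gb; lia.
by rewrite -big_seq big_const_seq count_predT size_iota iter_addr_0 mulr_natl.
Qed.

(** Each of the d values occurs once or twice, so 2d - [size p] of them occur once; the term in e -
    f corrects for value 1, the current best. *)
Lemma sum_rep d p (g : nat -> rat) e f : dense d p ->
  (count_mem 1%N p == 1%N -> g 1%N = e) ->
  (forall x, (1 < x <= d)%N -> count_mem x p == 1%N -> g x = f) ->
  \sum_(x <- iota 1 d | count_mem x p == 1%N) g x =
  (count_mem 1%N p == 1%N)%:R * (e - f) + (2 * d%:R - (size p)%:R) * f.
Proof.
move=> dp ge gf.
have pI : {subset p <= iota 1 d}.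
  by move=> v; rewrite (dp v).1 mem_iota add1n ltnS.
(* The factor 2 - count is 1 for a value seen once and 0 for one seen twice, which makes the sum
   linear in the counts. *)
have -> : \sum_(x <- iota 1 d | count_mem x p == 1%N) g x =
    \sum_(x <- iota 1 d) ((x == 1%N)%:R * ((count_mem x p == 1%N)%:R * (e - f)) +
      (2 - (count_mem x p)%:R) * f).
  rewrite big_mkcond big_seq [RHS]big_seq; apply: eq_bigr => x.
  rewrite mem_iota add1n ltnS => xI.
  have : (0 < count_mem x p <= 2)%N by rewrite -has_count has_pred1 (dp x).1 xI (dp x).2.
  case E : (count_mem x p) => [|[|[|]]] // _; last by rewrite /= mul0r mulr0 subrr mul0r addr0.
  rewrite eqxx; case: eqP => [x1|x1].
    by rewrite x1 in E *; rewrite ge ?E //=; ring. 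
  by rewrite gf ?E //=; [ring|lia].
rewrite big_split /= -mulr_suml sumrB (size_sum_count (iota_uniq 1 d) pI) natr_sum.
rewrite big_const_seq count_predT size_iota iter_addr_0 mulr_natr.
congr (_ + _).
have [p1|p1] := boolP (count_mem 1%N p == 1%N); last first.
  rewrite mul0r big1 // => x _; case: eqP => [->|_]; last by rewrite mul0r.
  by rewrite (negbTE p1) mul0r mulr0.
have : (0 < 1 <= d)%N by rewrite -(dp 1%N).1 -has_pred1 has_count (eqP p1).
case: (d) => // d' _; rewrite (@sum_new d' _ (e - f) 0); last 2 first.
- by rewrite p1 !mul1r.
- by move=> x xI; case: eqP => [|_]; [lia|rewrite mul0r].
by rewrite mulr0 addr0 mul1r.
Qed.

(** The bracket counts the remaining applicants: 2(n-d) carry unseen ranks, spread evenly over d+1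
    positions of which only the first is a new best, and 2d - [size p] complete a pair. The four
    constants are the values of g for a new best, another new value, a repeated best and another
    repeat. *)
Lemma sum_children n k d p (g : nat * seq nat -> rat) a b e f :
  dense d p -> (d <= n)%N ->
  ((d < n)%N -> g (d.+1, rcons (map (bump 1) p) 1%N) = a) ->
  ((d < n)%N -> forall x, (1 < x <= d.+1)%N ->
     g (d.+1, rcons (map (bump x) p) x) = b) ->
  (count_mem 1%N p == 1%N -> g (d, rcons p 1%N) = e) ->
  (forall x, (1 < x <= d)%N -> count_mem x p == 1%N -> g (d, rcons p x) = f) ->
  \sum_(c <- children n d p) weight n k c.1 * g c =
  weight n k d * (2 * (n - d)%:R * ((a + d%:R * b) / d.+1%:R) +
    (count_mem 1%N p == 1%N)%:R * (e - f) + (2 * d%:R - (size p)%:R) * f).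
Proof.
move=> dp dn ga gb ge gf; rewrite /children big_cat.
rewrite -addrA mulrDr; congr (_ + _); last first.
  rewrite big_map big_filter /= -mulr_sumr; congr (_ * _).
  exact: (@sum_rep d p (fun x => g (d, rcons p x))).
case: ltnP => [dn'|nd]; last first.
  have -> : (n - d = 0)%N by lia.
  by rewrite big_nil mulr0 mul0r mulr0.
transitivity (weight n k d.+1 *
    \sum_(x <- iota 1 d.+1) g (d.+1, rcons (map (bump x) p) x)).
  by rewrite mulr_sumr big_map.
rewrite (@sum_new d (fun x => g (d.+1, rcons (map (bump x) p) x)) _ _ (ga dn') (gb dn')).
have d0 : d.+1%:R != 0 :> rat by rewrite pnatr_eq0.
apply: (mulfI d0); rewrite [LHS]mulrA weight_new //.
by move: d0; set y := d.+1%:R => d0; field.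
Qed.

Lemma count_leavesS n k d p (Q : pred (seq nat)) :
  (count Q (leaves n k.+1 d p))%:R =
  \sum_(c <- children n d p) (count Q (leaves n k c.1 c.2))%:R :> rat.
Proof. by rewrite /= count_flatten -map_comp sumnE big_map natr_sum. Qed.

Lemma remaining_interviews n s k : (s + k.+1 = n.*2)%N ->
  k.+1%:R = 2 * n%:R - s%:R :> rat.
Proof. by move=> sk; rewrite -natrM mul2n -sk natrD; ring. Qed.

Lemma size_leaves n k d p : dense d p -> (d <= n)%N ->
  (size p + k = n.*2)%N -> (size (leaves n k d p))%:R = weight n k d.
Proof.
elim: k d p => [|k IH] d p dp dn sk.
  have -> : d = n by apply: (dense_full dp dn); rewrite -sk addn0.
  by rewrite /weight subnn binn fact0 expr0 divr1 mulr1.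
rewrite -count_predT count_leavesS.
rewrite (eq_big_seq (fun c => weight n k c.1 * 1)); last first.
  move=> c /(dense_children dp dn)[dc cn sc _].
  by rewrite count_predT IH ?mulr1 // sc -sk addSnnS.
rewrite (@sum_children n k d p (fun=> 1) 1 1 1 1) // weight_step mulrC.
rewrite (remaining_interviews sk) natrB // -(@natr1 rat d); field.
by rewrite natr1 pnatr_eq0.
Qed.

Lemma rank_fun_rcons p x i : (0 < i <= size p)%N ->
  rank_fun (rcons p x) i = rank_fun p i.
Proof. by case: i => // i /= ip; rewrite /rank_fun /= nth_rcons ip. Qed.

Lemma rank_fun_map f p i : (0 < i <= size p)%N ->
  rank_fun (map f p) i = f (rank_fun p i).
Proof. by case: i => // i ip; rewrite /rank_fun /= (nth_map 0%N). Qed.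

Lemma mem_rank_fun p i : (0 < i <= size p)%N -> rank_fun p i \in p.
Proof. by case: i => // i ip; apply: mem_nth. Qed.

(** The chance d/n of the current best is a martingale: a new value spares it in d of d+1 positions,
    and d/(d+1) times (d+1)/n is d/n again, while a repeat changes nothing. *)
Lemma count_leaves_best n k d p i : (0 < n)%N -> dense d p -> (d <= n)%N ->
  (size p + k = n.*2)%N -> (0 < i <= size p)%N ->
  (count (fun l => rank_fun l i == 1%N) (leaves n k d p))%:R =
  weight n k d * ((rank_fun p i == 1%N)%:R * (d%:R / n%:R)).
Proof.
move=> n0; elim: k d p => [|k IH] d p dp dn sk iI.
  have -> : d = n by apply: (dense_full dp dn); rewrite -sk addn0.
  rewrite /= addn0 /weight subnn binn fact0 expr0 divr1 !mulr1 divff ?mulr1 ?mul1r //.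
  by rewrite pnatr_eq0; lia.
rewrite count_leavesS.
rewrite (eq_big_seq (fun c => weight n k c.1 *
  ((rank_fun c.2 i == 1%N)%:R * (c.1%:R / n%:R)))); last first.
  by move=> c /(dense_children dp dn)[dc cn sc _]; rewrite IH // sc; lia.
have pi : rank_fun p i \in p.
  exact: mem_rank_fun.
rewrite (dp _).1 in pi.
have iI' x : (0 < i <= size (map (bump x) p))%N by rewrite size_map.
set q := (rank_fun p i == 1%N)%:R.
rewrite (@sum_children n k d p _ 0 (q * (d.+1%:R / n%:R))
   (q * (d%:R / n%:R)) (q * (d%:R / n%:R))) //=; first last.
- by move=> x _ _; rewrite rank_fun_rcons.
- by move=> _; rewrite rank_fun_rcons.
- move=> _ x xI; rewrite rank_fun_rcons // rank_fun_map // /q; congr (_%:R * _).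
  rewrite /bump; lia.
- move=> _; rewrite rank_fun_rcons // rank_fun_map // /bump.
  by case: eqP => [|_]; [lia|rewrite mul0r].
have n0' : n%:R != 0 :> rat by rewrite pnatr_eq0; lia.
rewrite weight_step (remaining_interviews sk) natrB // -(@natr1 rat d); field.
by rewrite n0' natr1 pnatr_eq0.
Qed.

(** Optimal win probability when p is passed over. What matters is whether the current best can
    still be repeated, so the empty pattern goes with the patterns whose best has appeared twice. *)
Definition cont_value (n d : nat) (p : seq nat) : rat :=
  if count_mem 1%N p == 1%N then value_once n d else value_twice n d.

(** The last entry is the applicant just interviewed; stopping there can pay only if it is the
    current best. *)
Definition node_value (n : nat) (c : nat * seq nat) : rat :=
  if last 0%N c.2 == 1%N then Num.max (c.1%:R / n%:R) (cont_value n c.1 c.2)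
  else cont_value n c.1 c.2.

(** The dynamic programming equation. Repeats of values other than the best leave the continuation
    value unchanged, so their terms cancel and k drops out; this is why u and v depend on d
    alone. *)
Lemma sum_node_value n k d p : (0 < n)%N -> dense d p -> (d <= n)%N ->
  (size p + k.+1 = n.*2)%N ->
  \sum_(c <- children n d p) weight n k c.1 * node_value n c =
  weight n k.+1 d * cont_value n d p.
Proof.
move=> n0 dp dn sk.
have cnt1 x : x != 1%N -> count_mem 1%N (rcons p x) = count_mem 1%N p.
  by move=> /negbTE x1; rewrite -cats1 count_cat /= x1 !addn0.
have cnt0 : count_mem 1%N (rcons (map (bump 1) p) 1%N) = 1%N.
  by rewrite -cats1 count_cat count_mem_bump eqxx.
have cntx x : (1 < x)%N ->
    count_mem 1%N (rcons (map (bump x) p) x) = count_mem 1%N p.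
  move=> x1; rewrite -cats1 count_cat count_mem_bump /=.
  have -> : (1%N == x) = false by lia.
  have -> : (x == 1%N) = false by lia.
  by rewrite !addn0; congr (count_mem _ p); rewrite /unbump; lia.
have dR : d.+1%:R != 0 :> rat by rewrite pnatr_eq0.
have nE : (n - d)%:R = n%:R - d%:R :> rat by rewrite natrB.
have [p1|p1] := boolP (count_mem 1%N p == 1%N).
- rewrite (@sum_children n k d p _ (value_once n d.+1) (value_once n d.+1)
    (Num.max (d%:R / n%:R) (value_twice n d)) (value_once n d)) //; first last.
  + move=> x xI _; rewrite /node_value /= last_rcons /cont_value cnt1 ?p1; last by lia.
    by case: eqP => // ; lia.
  + by move=> _; rewrite /node_value /= last_rcons /cont_value -cats1 count_cat (eqP p1).
  + move=> dn' x xI; rewrite /node_value /= last_rcons /cont_value cntx ?p1; last by lia.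
    by case: eqP => //; lia.
  (* A new best has appeared once, and u dominates the reward for stopping. *)
  + move=> dn'; rewrite /node_value /= last_rcons /cont_value cnt0 eqxx max_r //.
    exact: value_once_ge.
  rewrite /cont_value p1 weight_step (remaining_interviews sk).
  have := value_once_rec n0 dn.
  set M := Num.max _ _; set U := value_once n d; set U' := value_once n d.+1.
  have -> : (U' + d%:R * U') / d.+1%:R = U' :> rat.
    by move: dR; rewrite -(@natr1 rat d) => dR; field.
  move=> H; have -> : M = (2 * (n - d)%:R + 1) * U - 2 * (n - d)%:R * U'.
    by rewrite -H; ring.
  rewrite nE /=; ring.
(* The 0 stands for a repeat of the current best, which cannot occur in this case. *)
- rewrite (@sum_children n k d p _ (value_once n d.+1) (value_twice n d.+1)
    0 (value_twice n d)) //; first last.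
  + move=> x xI _; rewrite /node_value /= last_rcons /cont_value cnt1 ?(negbTE p1); last by lia.
    by case: eqP => // ; lia.
  + by rewrite (negbTE p1).
  + move=> dn' x xI; rewrite /node_value /= last_rcons /cont_value cntx ?(negbTE p1); last by lia.
    by case: eqP => //; lia.
  + move=> dn'; rewrite /node_value /= last_rcons /cont_value cnt0 eqxx max_r //.
    exact: value_once_ge.
  rewrite /cont_value (negbTE p1) weight_step (remaining_interviews sk) mul0r addr0.
  move: dn; rewrite leq_eqVlt => /orP[/eqP dn|dn].
    rewrite dn value_twice_max subnn; ring.
  rewrite -value_twice_rec // -(@natr1 rat d) nE.
  by move: dR; rewrite -(@natr1 rat d) => dR; field.
Qed.

(** * Optimality among arrangements *)

(** Here j applicants have been seen and k remain, so the recursion runs in step with [leaves].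
    Never stopping counts as a failure. *)
Fixpoint succeeds (b : (nat -> nat) -> nat -> bool) (k j : nat)
    (r : nat -> nat) : bool :=
  if k is k'.+1 then
    if b r j.+1 then r j.+1 == 1%N else succeeds b k' j.+1 r
  else false.

Definition adapted (b : (nat -> nat) -> nat -> bool) : Prop :=
  forall r r' j, (0 < j)%N -> obs r j = obs r' j -> b r j = b r' j.

(* The disjunct [j == n.*2] forces a stop at the last applicant. *)
Definition opt_rule (n : nat) (r : nat -> nat) (j : nat) : bool :=
  [&& relrank r j == 1%N, nbest r j == 2%N & (threshold n <= ndistinct r j)%N]
  || (j == n.*2).

Lemma opt_rule_adapted n : adapted (opt_rule n).
Proof.
move=> r r' j j0 E; rewrite /opt_rule (nbest_obs j0 E).
have [|-> -> //] := (obsP r r' j).1 E j; lia.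
Qed.

Lemma threshold_le n : (threshold n <= n)%N.
Proof. by apply/bigminn_leqP; left. Qed.

Section Optimality.
Variable n : nat.
Hypothesis n_gt0 : (0 < n)%N.

Lemma cont_value_ge0 d p : (d <= n)%N -> 0 <= cont_value n d p.
Proof.
move=> dn; rewrite /cont_value; case: ifP => _; last exact: value_twice_ge0.
by apply: le_trans (value_once_ge n_gt0 dn); rewrite divr_ge0.
Qed.

Lemma stop_le_node_value c : (c.1 <= n)%N ->
  (last 0%N c.2 == 1%N)%:R * (c.1%:R / n%:R) <= node_value n c.
Proof.
move=> cn; rewrite /node_value; case: eqP => _; first by rewrite mul1r le_max lexx.
by rewrite mul0r cont_value_ge0.
Qed.

Lemma cont_le_node_value c : cont_value n c.1 c.2 <= node_value n c.
Proof. by rewrite /node_value; case: ifP => // _; rewrite le_max lexx orbT. Qed.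

(** The rule attains the maximum at every node: a first appearance is passed because u d >= d/n, and
    a second one is decided by comparing v d with d/n on either side of the threshold. *)
Lemma opt_rule_node_value d p x : dense d (rcons p x) -> (d <= n)%N ->
  (size p < n.*2)%N ->
  (if opt_rule n (rank_fun (rcons p x)) (size p).+1
   then (x == 1%N)%:R * (d%:R / n%:R) else cont_value n d (rcons p x)) =
  node_value n (d, rcons p x).
Proof.
move=> dp dn sp.
have sc : size (rcons p x) = (size p).+1 by rewrite size_rcons.
(* At the last interview d = n and value 1 has occurred twice, so the forced stop loses nothing: v n
   = 0. *)
have full : (size p).+1 = n.*2 -> d = n /\ count_mem 1%N (rcons p x) = 2.
  move=> sp'; rewrite -sc in sp'; split; first exact: dense_full sp'.
  by apply: (full_count dp dn sp'); rewrite n_gt0.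
have d0 : (0 < d)%N by have := (dp x).1; rewrite mem_rcons inE eqxx; lia.
rewrite /opt_rule (dense_relrank dp) -sc (dense_nbest d0 dp) (dense_ndistinct dp) sc.
rewrite /node_value /= last_rcons /cont_value.
case: eqP => [x1|_] /=; last first.
  by case: eqP => // /full[-> ->] /=; rewrite value_twice_max mul0r.
have : (0 < count_mem 1%N (rcons p x) <= 2)%N.
  by rewrite (dp _).2 andbT -has_count has_pred1 (dp _).1 d0.
case E : (count_mem 1%N (rcons p x)) => [|[|[|]]] //= _.
  case: eqP => [/full[_]|_]; first by rewrite E.
  by rewrite max_r // value_once_ge.
have [td|dt] /= := leqP (threshold n) d.
  by rewrite mul1r max_l // value_twice_le // td.
case: eqP => [/full[dn' _]|_].
  by move: dt; rewrite dn' ltnNge threshold_le.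
by rewrite max_r // value_twice_ge.
Qed.

(** All leaves below a child share its observations, so an adapted rule takes one decision for the
    whole subtree; if it stops, [count_leaves_best] evaluates the outcome. *)
Lemma count_stop b k d p : adapted b -> dense d p -> (d <= n)%N ->
  (size p + k.+1 = n.*2)%N ->
  (count (fun l => succeeds b k.+1 (size p) (rank_fun l))
     (leaves n k.+1 d p))%:R =
  \sum_(c <- children n d p)
    if b (rank_fun c.2) (size p).+1
    then weight n k c.1 * ((last 0%N c.2 == 1%N)%:R * (c.1%:R / n%:R))
    else (count (fun l => succeeds b k (size c.2) (rank_fun l))
     (leaves n k c.1 c.2))%:R.
Proof.
move=> badapt dp dn sk; rewrite count_leavesS.
apply: eq_big_seq => c cI.
have [dc cn sc _] := dense_children dp dn cI.
have [q [x [qE sq]]] := children_last cI.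
have bE l : l \in leaves n k c.1 c.2 ->
    b (rank_fun l) (size p).+1 = b (rank_fun c.2) (size p).+1.
  by move=> lI; apply: badapt => //; apply: (obs_leaf dc cn lI); rewrite sc.
have -> : last 0%N c.2 = rank_fun c.2 (size p).+1.
  by rewrite qE last_rcons -sq rank_fun_last.
case: ifP => bc.
  rewrite -count_leaves_best // ?sc //; last 2 first.
  - by rewrite addSnnS.
  - by rewrite leqnn.
  congr (_%:R); apply: eq_in_count => l lI /=.
  by rewrite bE // bc.
congr (_%:R); apply: eq_in_count => l lI /=.
by rewrite bE // bc sc.
Qed.

(** Backward induction: stopping and continuing are each bounded by the node value, and node values
    sum to the parent's continuation value. *)
Lemma count_rule_le b k d p : adapted b -> dense d p -> (d <= n)%N ->
  (size p + k = n.*2)%N ->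
  (count (fun l => succeeds b k (size p) (rank_fun l)) (leaves n k d p))%:R <=
  weight n k d * cont_value n d p.
Proof.
move=> badapt; elim: k d p => [|k IH] d p dp dn sk.
  by rewrite /= mulr_ge0 ?cont_value_ge0 // ltW ?weight_gt0.
rewrite count_stop // -(sum_node_value n_gt0 dp dn sk).
rewrite big_seq [leRHS]big_seq; apply: ler_sum => c cI.
have [dc cn sc _] := dense_children dp dn cI.
have w0 := ltW (weight_gt0 k cn).
case: ifP => _; first by rewrite ler_wpM2l // stop_le_node_value.
apply: le_trans (IH _ _ dc cn _) _; first by rewrite sc addSnnS.
by rewrite ler_wpM2l // cont_le_node_value.
Qed.

Lemma count_opt_rule k d p : dense d p -> (d <= n)%N ->
  (size p + k = n.*2)%N ->
  (count (fun l => succeeds (opt_rule n) k (size p) (rank_fun l))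
     (leaves n k d p))%:R = weight n k d * cont_value n d p.
Proof.
elim: k d p => [|k IH] d p dp dn sk.
  rewrite addn0 in sk; rewrite /cont_value (full_count dp dn sk) ?n_gt0 //=.
  by rewrite (dense_full dp dn sk) value_twice_max mulr0.
rewrite (count_stop (@opt_rule_adapted n)) // -(sum_node_value n_gt0 dp dn sk).
apply: eq_big_seq => c cI.
have [dc cn sc _] := dense_children dp dn cI.
rewrite IH // ?sc ?addSnnS //.
have [q [x [qE sq]]] := children_last cI.
case: c {cI} dc cn sc qE => c1 c2 /= dc cn sc qE; rewrite qE in dc sc *.
rewrite -opt_rule_node_value // ?sq ?last_rcons; last by lia.
by case: ifP.
Qed.

Definition arrangements : seq (seq nat) := leaves n n.*2 0 [::].

Lemma opt_rule_optimal b : adapted b ->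
  (count (fun l => succeeds b n.*2 0 (rank_fun l)) arrangements <=
   count (fun l => succeeds (opt_rule n) n.*2 0 (rank_fun l)) arrangements)%N.
Proof.
move=> badapt; rewrite -(ler_nat rat).
have := @count_opt_rule n.*2 0 [::] dense_nil (leq0n n) erefl.
rewrite /= => ->.
exact: (@count_rule_le b n.*2 0 [::] badapt dense_nil (leq0n n)).
Qed.

(** There are as many leaves as distinct arrangements of the multiset, which gives the leaves total
    probability 1. *)
Lemma size_arrangements : (size arrangements * 2 ^ n = (n.*2)`!)%N.
Proof.
apply/eqP; rewrite -(eqr_nat rat) natrM natrX.
rewrite (size_leaves dense_nil) // /weight bin0 mul1r subn0 divfK //.
Qed.

End Optimality.

Local Open Scope classical_set_scope.

(** * The two forms of the optimal rule *)

Lemma tau_opt_leq n r j : (0 < n)%N -> (j <= n.*2)%N ->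
  (tau_opt n r <= j)%N = has (opt_rule n r) (iota 1 j).
Proof.
move=> n0 jn; apply/bigminn_leqP/hasP => [[nj|[i [iI Hi ij]]]|[i]].
- exists n.*2; first by rewrite mem_iota; lia.
  by rewrite /opt_rule eqxx orbT.
- exists i; first by rewrite mem_iota; lia.
  by rewrite /opt_rule Hi.
- rewrite mem_iota => iI /orP[Hi|/eqP ij]; last by left; lia.
  by right; exists i; split=> //; lia.
Qed.

Lemma tau_opt_bounds n r : (0 < n)%N -> (0 < tau_opt n r <= n.*2)%N.
Proof.
move=> n0; apply/andP; split; last by apply/bigminn_leqP; left.
by rewrite ltnNge tau_opt_leq.
Qed.

Lemma has_adapted b r r' j : adapted b -> obs r j = obs r' j ->
  has (b r) (iota 1 j) = has (b r') (iota 1 j).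
Proof.
move=> badapt E; apply: eq_in_has => i; rewrite mem_iota => iI.
by apply: badapt; [lia|apply: obs_prefix E; lia].
Qed.

Lemma succeeds_first b k j r t : (j < t <= j + k)%N ->
  (forall i, (j < i < t)%N -> ~~ b r i) -> b r t ->
  succeeds b k j r = (r t == 1%N).
Proof.
elim: k j => [|k IH] j tI bF bt; first by lia.
rewrite /=; have [jt|jt] := eqVneq j.+1 t; first by rewrite jt bt.
rewrite (negbTE (bF j.+1 _)); last by lia.
by apply: IH => // [|i iI]; [lia|apply: bF; lia].
Qed.

Lemma succeeds_tau_opt n r : (0 < n)%N ->
  succeeds (opt_rule n) n.*2 0 r = (r (tau_opt n r) == 1%N).
Proof.
move=> n0; have tI := tau_opt_bounds r n0.
have bF i : (0 < i < tau_opt n r)%N -> ~~ opt_rule n r i.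
  move=> iI; apply/negP => bi.
  have : (tau_opt n r <= i)%N.
    rewrite tau_opt_leq //; last by lia.
    by apply/hasP; exists i => //; rewrite mem_iota; lia.
  lia.
apply: succeeds_first => //.
have /andP[_ tn] := tI; have := tau_opt_leq r n0 tn; rewrite leqnn.
move=> /esym/hasP[i]; rewrite mem_iota => iI bi.
have -> // : tau_opt n r = i.
have [lt|] := ltnP i (tau_opt n r); last by lia.
by have := bF i; rewrite bi lt andbT => /(_ _)/negP; case=> //; lia.
Qed.

Lemma succeeds_ext b k j r r' : adapted b ->
  (forall i, (0 < i <= j + k)%N -> r i = r' i) ->
  succeeds b k j r = succeeds b k j r'.
Proof.
move=> badapt; elim: k j => //= k IH j E.
rewrite E; last by lia.
rewrite (badapt r r' j.+1) //; last by apply: eq_obs => i iI; apply: E; lia.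
by rewrite IH // => i iI; apply: E; lia.
Qed.

Lemma best_timeS n r j : (0 < j)%N ->
  best_time n r j.+1 =
  \big[minn/n.*2]_(1 <= i < n.*2.+1 | (best_time n r j < i)%N && (relrank r i == 1%N)) i.
Proof. by case: j. Qed.

(** Before the default 2n is reached, the times are genuine and strictly increasing; the bound j <=
    T_j guarantees that i steps reach or pass time i. *)
Lemma best_time_spec n r j : (0 < j)%N -> (best_time n r j < n.*2)%N ->
  (j <= best_time n r j)%N && (relrank r (best_time n r j) == 1%N).
Proof.
elim: j => // j IH _; case: (posnP j) => [->|j0] lt; first by rewrite /relrank /= leqnn.
have := leqnn (best_time n r j.+1).
rewrite {1}best_timeS // => /bigminn_leqP[|[i [iI /andP[ji ri] it]]]; first by lia.
have jn : (best_time n r j < n.*2)%N by lia.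
have /andP[jj _] := IH j0 jn.
have E : best_time n r j.+1 = i.
  apply/eqP; rewrite eqn_leq it andbT best_timeS //.
  by apply/bigminn_leqP; right; exists i; split => //; rewrite ?ji.
by rewrite E ri andbT; lia.
Qed.

Lemma best_time_onto n r i : (0 < i < n.*2)%N -> relrank r i == 1%N ->
  exists2 j, (0 < j <= i)%N & best_time n r j = i.
Proof.
move=> iI ri.
(* The sequence cannot jump over i, because i is itself a candidate for the next best time. *)
have H m : (0 < m)%N ->
    (exists2 j, (0 < j <= m)%N & best_time n r j = i) \/ (best_time n r m < i)%N.
  elim: m => // m IH _; case: (posnP m) => [->|m0].
    by have [i1|i1] := eqVneq i 1%N; [left; exists 1%N|right => /=; lia].
  case: (IH m0) => [[j jI ji]|lt]; first by left; exists j => //; lia.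
  have : (best_time n r m.+1 <= i)%N.
    rewrite best_timeS //; apply/bigminn_leqP; right; exists i.
    by rewrite lt ri; split=> //; lia.
  rewrite leq_eqVlt => /orP[/eqP E|?]; last by right.
  by left; exists m.+1 => //; rewrite leqnn.
have [|jE|lt] := H i; [by lia|exact: jE|].
have [||] := andP (@best_time_spec n r i _ _); lia.
Qed.

(** Both minima default to 2n, so only bounds t < 2n matter; below 2n the times with X = 1 are
    exactly the values of [best_time]. *)
Lemma tau_opt_best_time n r : tau_opt n r = first_good_best_time n r.
Proof.
suff E t : (tau_opt n r <= t)%N = (first_good_best_time n r <= t)%N.
  by apply/eqP; rewrite eqn_leq E leqnn -E leqnn.
have [nt|tn] := leqP n.*2 t.
  by transitivity true; [|symmetry]; apply/bigminn_leqP; left.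
apply/bigminn_leqP/bigminn_leqP => -[|]; try by lia.
- move=> [i [iI /and3P[ri si di] it]]; right.
  have [|j jI jE] := @best_time_onto n r i _ ri; first by lia.
  by exists j; rewrite jE di si; split=> //; lia.
- move=> [j [jI /andP[dj sj] jt]]; right; exists (best_time n r j).
  have /andP[jj rj] : (j <= best_time n r j)%N && (relrank r (best_time n r j) == 1%N).
    by apply: best_time_spec; lia.
  by rewrite rj sj dj; split=> //; lia.
Qed.

(** * Stopping rules and probabilities *)

Section Saturation.
Variables (T : Type) (G : set (set T)).
Hypothesis sigmaG : sigma_algebra setT G.

Lemma sigma_algebra_setI A B : G A -> G B -> G (A `&` B).
Proof.
case: (sigmaG) => _ GC GU GA GB.
have -> : A `&` B = setT `\` \bigcup_k (if k is 0%N then setT `\` A else setT `\` B).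
  rewrite predeqE => x; split=> [[Ax Bx]|[_ H]].
    by split=> // -[[|k] _ []].
  split; apply: contrapT => nx; apply: H; first by exists 0%N.
  by exists 1%N.
by apply: (GC); apply: GU => -[|k]; apply: (GC).
Qed.

(** A is the union of the fibres of h that it meets, and there are countably many of them. *)
Lemma sigma_algebra_saturated (C : countType) (h : T -> C) A :
  (forall c, G (h @^-1` [set c])) ->
  (forall w w', h w = h w' -> A w -> A w') -> G A.
Proof.
case: (sigmaG) => G0 _ GU Gh satA.
have -> : A = \bigcup_k (if unpickle k is Some c
    then if `[< (h @` A) c >] then h @^-1` [set c] else set0 else set0).
  rewrite predeqE => w; split=> [Aw|[k _]].
    exists (pickle (h w)) => //; rewrite pickleK.
    by case: asboolP => // -[]; exists w.
  case: unpickle => // c; case: asboolP => // -[w' Aw' <-] /= E.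
  by apply: satA Aw'.
apply: GU => k; case: unpickle => // c; case: asboolP => // _.
Qed.

Lemma sigma_algebra_map (I : eqType) (C : eqType) (g : I -> T -> C) (s : seq I) c :
  (forall i x, i \in s -> G [set w | g i w = x]) ->
  G [set w | [seq g i w | i <- s] = c].
Proof.
case: (sigmaG) => G0 GC _.
elim: s c => [|i s IH] [|x c] Gg /=.
- have -> : [set w : T | [::] = [::] :> seq C] = setT `\` set0.
    by rewrite setD0 predeqE.
  exact: GC.
- by have -> : [set w : T | [::] = x :: c] = set0 by rewrite predeqE => w; split.
- have -> // : [set w | g i w :: [seq g i w | i <- s] = [::]] = set0.
  by rewrite predeqE => w; split.
have -> : [set w | g i w :: [seq g i w | i <- s] = x :: c] =
    [set w | g i w = x] `&` [set w | [seq g i w | i <- s] = c].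
  by rewrite predeqE => w; split=> [[? ?]|[/= -> ->]].
apply: sigma_algebra_setI; first by apply: Gg; rewrite inE eqxx.
by apply: IH => j y js; apply: Gg; rewrite inE js orbT.
Qed.

End Saturation.

Lemma measurable_sigma_algebra d (T : measurableType d) :
  sigma_algebra setT (@measurable d T).
Proof.
split; first exact: measurable0.
  by move=> A mA; apply: measurableD => //; exact: measurableT.
by move=> A mA; apply: bigcupT_measurable.
Qed.

Section Model.
Context d (T : measurableType d) (R : realType) (P : probability T R).
Variable rk : nat -> {RV P >-> nat}.

Lemma obs_in_filtration j A :
  (forall w w', obs (ranks rk w) j = obs (ranks rk w') j -> A w -> A w') ->
  observed_filtration rk j A.
Proof.
have sG : sigma_algebra setT (observed_filtration rk j).
  exact: smallest_sigma_algebra.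
apply: (sigma_algebra_saturated sG) => c.
apply: (sigma_algebra_map sG) => i x; rewrite mem_iota => iI.
apply: sub_sigma_algebra.
case: i iI => // i iI; have ij : (i < j)%N by lia.
rewrite (bigD1 (Ordinal ij)) //=; left; exists [set x].
  have -> : [set x] = [set x.1] `*` [set x.2].
    by case: x => a b; rewrite predeqE => -[u v]; split=> [[-> ->]|[/= -> ->]].
  exact: measurableX.
by rewrite setTI.
Qed.

(** Sets that depend only on the observations up to j form a sigma-algebra containing the
    generators. With [obs_in_filtration], this describes the filtration completely. *)
Lemma filtration_saturated j A : observed_filtration rk j A ->
  forall w w', obs (ranks rk w) j = obs (ranks rk w') j -> A w -> A w'.
Proof.
move: A; apply: smallest_sub.
  split=> //.
  - move=> A HA w w' E [_ nA]; split=> // A'; apply: nA.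
    (* For complements the two outcomes exchange roles. *)
    exact: (HA w' w).
  - move=> A HA w w' E [k _ Ak]; exists k => //.
    exact: (HA k w w').
elim/big_ind: _ => //.
  by move=> A B HA HB X [/HA|/HB].
move=> i _ X [B _ <-] w w' /obsP E [_ Bw]; split=> //.
move: Bw => /=; have [|-> -> //] := E i.+1; by have := ltn_ord i; lia.
Qed.

Definition rank_list n w := [seq rk j w | j <- iota 1 n.*2].

Lemma rank_list_fun n w j : (0 < j <= n.*2)%N ->
  rank_fun (rank_list n w) j = rk j w.
Proof.
case: j => // j /= jn; rewrite /rank_fun /rank_list /=.
by rewrite (nth_map 0%N) ?size_iota // nth_iota.
Qed.

Lemma measurable_rank_list n (Q : pred (seq nat)) :
  measurable [set w | Q (rank_list n w)].
Proof.
apply: (sigma_algebra_saturated (@measurable_sigma_algebra _ T) (h := rank_list n)).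
  move=> c; apply: (sigma_algebra_map (@measurable_sigma_algebra _ T)) => i x _.
  by rewrite -[X in measurable X]setTI; exact: (measurable_funPT (rk i) measurableT [set x]).
by move=> w w' /= ->.
Qed.

Section Uniform.
Variable n : nat.
Hypothesis n_gt0 : (0 < n)%N.
Hypothesis rk_unif : uniform_order n rk.
Let p : R := (2 ^ n)%N%:R / (n.*2)`!%:R.

Lemma prob_arrangements (s : seq (seq nat)) : uniq s ->
  {subset s <= arrangements n} ->
  P [set w | rank_list n w \in s] = ((size s)%:R * p)%:E.
Proof.
elim: s => [|l s IH] /= => [_ _|/andP[ls us] sub].
  by rewrite mul0r -[RHS](measure0 P); congr (P _); rewrite predeqE => w; split.
have -> : [set w | rank_list n w \in l :: s] =
    [set w | rank_list n w == l] `|` [set w | rank_list n w \in s].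
  rewrite predeqE => w /=; rewrite inE; split=> [/orP[]|[->|->]]; rewrite ?orbT //.
    by left.
  by right.
rewrite measureU; first last.
- rewrite predeqE => w; split=> //= -[/eqP -> ]; exact/negP.
- exact: (measurable_rank_list n (mem s)).
- exact: (measurable_rank_list n (pred1 l)).
rewrite [X in (_ + X)%E]IH //; last by move=> y ys; apply: sub; rewrite inE ys orbT.
have -> : [set w | rank_list n w == l] = [set w | rank_list n w = l].
  by rewrite predeqE => w; split=> /eqP.
rewrite [X in (X + _)%E]rk_unif; last by apply: leaf_perm; apply: sub; rewrite inE eqxx.
by rewrite -EFinD -/p mulrSr mulrDl mul1r addrC.
Qed.

Lemma prob_all_arrangements : P [set w | rank_list n w \in arrangements n] = 1%E.
Proof.
rewrite prob_arrangements //; last exact: (uniq_leaves _ dense_nil).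
rewrite /p mulrA -natrM size_arrangements // divff //.
Qed.

Lemma prob_rank_list (Q : pred (seq nat)) :
  P [set w | Q (rank_list n w)] = ((count Q (arrangements n))%:R * p)%:E.
Proof.
have mA := measurable_rank_list n (mem (arrangements n)).
have mQ := measurable_rank_list n Q.
have nullA : P (~` [set w | rank_list n w \in arrangements n]) = 0%E.
  by rewrite probability_setC // prob_all_arrangements subee.
have -> : [set w | Q (rank_list n w)] =
   [set w | rank_list n w \in [seq l <- arrangements n | Q l]] `|`
   ([set w | Q (rank_list n w)] `&` ~` [set w | rank_list n w \in arrangements n]).
  rewrite predeqE => w /=; rewrite mem_filter; split=> [Qw|[/andP[]|[]] //].
  by case: (boolP (rank_list n w \in _)) => lw; [left; rewrite Qw|right; split=> //; exact/negP].
have mN := measurableI _ _ mQ (measurableC mA).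
rewrite measureU //; first last.
- rewrite predeqE => w; split=> //= -[]; rewrite mem_filter => /andP[_ ?] [_]; exact.
- exact: (measurable_rank_list n (mem [seq l <- arrangements n | Q l])).
rewrite [X in (X + _)%E]prob_arrangements; first last.
- by move=> l; rewrite mem_filter => /andP[].
- by rewrite filter_uniq // (uniq_leaves _ dense_nil).
rewrite [X in (_ + X)%E](_ : _ = 0%E) ?adde0 ?size_filter //.
by apply: subset_measure0 nullA => //; exact: measurableC.
Qed.

Lemma success_prob_rule b (tau : T -> nat) : adapted b ->
  (forall w, succeeds b n.*2 0 (ranks rk w) = (rk (tau w) w == 1%N)) ->
  success_prob rk tau =
  ((count (fun l => succeeds b n.*2 0 (rank_fun l)) (arrangements n))%:R * p)%:E.
Proof.
move=> badapt H; rewrite -prob_rank_list /success_prob; congr (P _).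
rewrite predeqE => w /=.
rewrite (succeeds_ext (r' := ranks rk w)) ?H //; first by split=> [/eqP|/eqP].
by move=> i iI; rewrite rank_list_fun.
Qed.

Lemma stopping_rule_succeeds tau : stopping_rule n rk tau ->
  exists2 b, adapted b &
  forall w, succeeds b n.*2 0 (ranks rk w) = (rk (tau w) w == 1%N).
Proof.
move=> [tauI tauF].
(* The existential extends the decision to all rank functions and makes it adapted by construction;
   on actual outcomes it agrees with tau, since the event tau <= j is saturated. *)
pose b r j := `[< exists w, obs (ranks rk w) j = obs r j /\ (tau w <= j)%N >].
have bE w j : (0 < j <= n.*2)%N -> b (ranks rk w) j = (tau w <= j)%N.
  move=> jI; apply/asboolP/idP => [[w' [E tj]]|tj]; last by exists w.
  exact: (filtration_saturated (tauF j jI) E tj).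
exists b; first by move=> r r' j _ E; rewrite /b E.
move=> w; apply: succeeds_first => //.
- by move=> i iI; have tI := tauI w; rewrite bE; lia.
- by rewrite bE.
Qed.

Lemma tau_opt_stopping : stopping_rule n rk (fun w => tau_opt n (ranks rk w)).
Proof.
split=> [w|j jI]; first exact: tau_opt_bounds.
apply: obs_in_filtration => w w' E /=.
rewrite !tau_opt_leq //; try by case/andP: jI.
by rewrite (has_adapted (@opt_rule_adapted n) E).
Qed.

Lemma tau_opt_optimal tau : stopping_rule n rk tau ->
  (success_prob rk tau <= success_prob rk (fun w => tau_opt n (ranks rk w)))%E.
Proof.
move=> /stopping_rule_succeeds[b badapt bE].
rewrite (success_prob_rule badapt bE) (success_prob_rule (@opt_rule_adapted n)).
  rewrite lee_fin ler_wpM2r ?divr_ge0 // ler_nat.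
  exact: opt_rule_optimal.
by move=> w; rewrite succeeds_tau_opt.
Qed.

End Uniform.
End Model.

Theorem theorem2p1 (d : measure_display) (T : measurableType d)
    (R : realType) (P : probability T R)
    (n : nat) (n_ge1 : (1 <= n)%N)
    (rk : nat -> {RV P >-> nat}) (rk_unif : uniform_order n rk) :
  [/\ stopping_rule n rk (fun w => tau_opt n (ranks rk w)),
      success_prob rk (fun w => tau_opt n (ranks rk w)) =
        ereal_sup [set success_prob rk tau | tau in stopping_rule n rk]
    & forall w, tau_opt n (ranks rk w) = first_good_best_time n (ranks rk w)].
Proof.
split; first exact: tau_opt_stopping.
- apply/eqP; rewrite eq_le; apply/andP; split.
    apply: ereal_sup_ubound; exists (fun w => tau_opt n (ranks rk w)) => //.
    exact: tau_opt_stopping.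
  apply: ge_ereal_sup => _ [tau tauS <-]; exact: tau_opt_optimal.
- by move=> w; apply: tau_opt_best_time.
Qed.
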